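(* Let $\mathbb{K}$ be a field, let $A=\{\mathbf{a}_1,\ldots,\mathbf{a}_m\}\subseteq\mathbb{N}^n$ be a finite set of nonzero vectors, and suppose that the toric ideal $I_A\subseteq\mathbb{K}[x_1,\ldots,x_m]$ is homogeneous (with respect to the standard grading). Then $I_A$ is generalized robust and generated by quadrics if and only if the universal Gröbner basis of $I_A$ consists only of quadrics.
   Context: For $\mathbf{u}\in\mathbb{N}^m$ let $\deg_A(\mathbf{x}^{\mathbf{u}})=u_1\mathbf{a}_1+\cdots+u_m\mathbf{a}_m$. The toric ideal $I_A\subseteq\mathbb{K}[x_1,\ldots,x_m]$ is generated by all binomials $\mathbf{x}^{\mathbf{u}}-\mathbf{x}^{\mathbf{v}}$ with $\deg_A(\mathbf{x}^{\mathbf{u}})=\deg_A(\mathbf{x}^{\mathbf{v}})$. A quadric is a homogeneous polynomial of degree two; the zero ideal is generated by quadrics (empty generating set). A Markov basis is a minimal generating set of $I_A$ consisting of binomials; the universal Markov basis $\mathcal{M}_A$ is the union of all Markov bases; the universal Gröbner basis $\mathcal{U}_A$ is the union of all reduced Gröbner bases of $I_A$ over all monomial orders. Binomials are considered up to sign. $I_A$ is generalized robust if $\mathcal{U}_A=\mathcal{M}_A$. *)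

(* Defs.v *)
From HB Require Import structures.
From mathcomp Require Import all_boot all_order all_algebra.
From mathcomp Require Import mpoly.

Set Implicit Arguments.
Unset Strict Implicit.
Unset Printing Implicit Defensive.

Import GRing.Theory.
Local Open Scope ring_scope.

Section Ideals.
Context {m : nat} {K : fieldType}.
Implicit Types (S I : {mpoly K[m]} -> Prop) (p f g : {mpoly K[m]}).

Definition ideal_gen S p : Prop :=
  exists (k : nat) (c g : 'I_k -> {mpoly K[m]}),
    (forall i, S (g i)) /\ p = \sum_(i < k) c i * g i.

Definition generates S I : Prop := forall p, ideal_gen S p <-> I p.

(* Every homogeneous component, for the standard grading, of an element of the
   ideal is in the ideal. *)
Definition homogeneous_ideal I : Prop :=
  forall p, I p -> forall d : nat, I (pihomog mdeg d p).

(* [2.-homog] holds of 0, which has no degree. *)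
Definition quadric p : bool := (p != 0) && (p \is 2.-homog).

Definition generated_by_quadrics I : Prop :=
  exists S, (forall f, S f -> quadric f) /\ generates S I.

Definition is_binomial f : Prop :=
  exists u v : 'X_{1..m}, f = 'X_[u] - 'X_[v].

Definition markov_basis I S : Prop :=
  [/\ forall f, S f -> is_binomial f,
      generates S I
    & forall S' : {mpoly K[m]} -> Prop,
        (forall f, S' f -> S f) -> generates S' I -> forall f, S f -> S' f].

Definition universal_markov_basis I f : Prop :=
  exists S, markov_basis I S /\ S f.

(* Total orders on the monomials that are compatible with multiplication and
   have 1 (the zero exponent) as least element; by Dickson's lemma these are
   well-orders. *)
Definition monomial_order (le : rel 'X_{1..m}) : Prop :=
  [/\ total le, antisymmetric le, transitive le,
      forall u v w : 'X_{1..m}, le u v -> le (u + w)%MM (v + w)%MM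
    & forall u : 'X_{1..m}, le 0%MM u].

(* Never holds for p = 0, whose support is empty. *)
Definition is_lead (le : rel 'X_{1..m}) p (u : 'X_{1..m}) : Prop :=
  u \in msupp p /\ forall v, v \in msupp p -> le v u.

Definition initial_ideal (le : rel 'X_{1..m}) S : {mpoly K[m]} -> Prop :=
  ideal_gen (fun h => exists f u, [/\ S f, is_lead le f u & h = 'X_[u]]).

Definition groebner_basis (le : rel 'X_{1..m}) I
    (G : seq {mpoly K[m]}) : Prop :=
  (forall g, g \in G -> I g) /\
  (forall p, initial_ideal le (fun g => g \in G) p <-> initial_ideal le I p).

Definition reduced_groebner_basis (le : rel 'X_{1..m}) I
    (G : seq {mpoly K[m]}) : Prop :=
  [/\ groebner_basis le I G,
      forall g, g \in G -> exists2 u, is_lead le g u & g@_u = 1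
    & forall g g' u v, g \in G -> g' \in G -> g != g' ->
        u \in msupp g -> is_lead le g' v -> ~~ (v <= u)%MM].

Definition universal_groebner_basis I f : Prop :=
  exists (le : rel 'X_{1..m}) (G : seq {mpoly K[m]}),
    [/\ monomial_order le, reduced_groebner_basis le I G & f \in G].

Definition up_to_sign S f : Prop := S f \/ S (- f).

Definition generalized_robust I : Prop :=
  forall f, up_to_sign (universal_groebner_basis I) f <->
            up_to_sign (universal_markov_basis I) f.

End Ideals.

Definition degA {n m : nat} (a : 'I_m -> 'rV[nat]_n) (u : 'X_{1..m}) :
    'rV[nat]_n :=
  \sum_(i < m) a i *+ u i.

Definition toric_ideal {n m : nat} (K : fieldType) (a : 'I_m -> 'rV[nat]_n) :
    {mpoly K[m]} -> Prop :=
  ideal_gen (fun f => exists u v : 'X_{1..m},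
    degA a u = degA a v /\ f = 'X_[u] - 'X_[v]).

Arguments toric_ideal {n m} K a _.

(* Main.v *)
Require Import Defs.
From mathcomp Require Import all_boot all_order all_algebra.
From mathcomp Require Import mpoly.
From Stdlib Require Import Classical_Prop.

Set Implicit Arguments.
Unset Strict Implicit.
Unset Printing Implicit Defensive.

Import GRing.Theory.
Local Open Scope ring_scope.

(** Fix a monomial order and call a monomial standard when it is the least
    monomial of its fibre for the A-grading. A polynomial of I_A cannot meet a
    fibre in a single monomial ([toric_fibre]: I_A is killed by the
    parametrisation x_i |-> t^(a_i), which sends x^u to t^(deg_A u)). Hence the
    monomials of the initial ideal are exactly the non-standard ones. By
    Dickson's lemma they have finitely many minimal elements x^b, and the
    binomials x^b - x^w, with x^w the standard monomial of the fibre of x^b,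
    form a reduced Gröbner basis ([reduced_groebner_basis_exists]).
    Conversely, every element of a reduced Gröbner basis is a binomial with a
    standard tail ([reduced_groebner_basis_binomial]), and such a basis
    generates I_A ([reduced_groebner_basis_generates]).

    If I_A is generated by quadrics then every Markov basis consists of
    quadrics ([markov_basis_quadric]): I_A has no nonzero element in degree
    less than 2, so taking components of degree 2 writes each quadric of I_A in
    terms of the quadrics of the Markov basis, and minimality leaves no room
    for anything else. When I_A is moreover generalized robust, this bounds the
    universal Gröbner basis as well.

    Suppose now that the universal Gröbner basis consists of quadrics. Any
    reduced Gröbner basis generates I_A, so I_A is generated by quadrics. A
    reduced Gröbner basis is a Markov basis
    ([reduced_groebner_basis_markov]): in degree 2 the ideal membership of one
    element in the span of others is linear dependence, but the leading
    monomial of each element occurs in no other element. Finally let x^u - x^v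
    be an element of a Markov basis, hence a quadric
    ([markov_basis_groebner]). Distinct monomials of degree 2 in one fibre are
    coprime, as cancelling a common variable would give a linear form in I_A.
    So under an order that first counts the variables not dividing x^v, the
    monomial x^v is standard, and x^u is a minimal generator of the initial
    ideal because I_A has no elements of lower degree. Thus x^u - x^v lies in
    the reduced Gröbner basis for that order. *)

(** * Least elements and Dickson's lemma *)

Lemma exists_least_in_seq (T : eqType) (le : rel T) (s : seq T) :
  total le -> transitive le -> s != [::] ->
  exists2 x, x \in s & forall y, y \in s -> le x y.
Proof.
move=> tot tr; elim: s => // x s IH _.
have le_xx y : le y y by have := tot y y; rewrite orbb.
have [->|/IH [z zs zP]] := eqVneq s [::].
  by exists x; rewrite ?mem_head // => y; rewrite inE => /eqP->.
have [xz|zx] := orP (tot x z).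
  exists x; rewrite ?mem_head // => y; rewrite inE => /predU1P [->//|/zP].
  exact: tr.
exists z; first by rewrite inE zs orbT.
by move=> y; rewrite inE => /predU1P [->//|/zP].
Qed.

Lemma seq_image_exists (T U : eqType) (R : T -> U -> Prop) (s : seq T) :
  (forall x, x \in s -> exists y, R x y) ->
  exists t : seq U, (forall x, x \in s -> exists2 y, y \in t & R x y) /\
                    (forall y, y \in t -> exists2 x, x \in s & R x y).
Proof.
elim: s => [|x s IH] sP; first by exists [::].
have [|t [st ts]] := IH; first by move=> z zs; apply: sP; rewrite inE zs orbT.
have [y xy] := sP x (mem_head x s).
exists (y :: t); split=> z; rewrite inE => /predU1P [->|zt].
- by exists y; rewrite ?mem_head.
- by have [w wt] := st z zt; exists w; rewrite // inE wt orbT.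
- by exists x; rewrite ?mem_head.
- by have [w ws] := ts z zt; exists w; rewrite // inE ws orbT.
Qed.

Section Dickson.
Context {m : nat}.
Implicit Types (P : 'X_{1..m} -> Prop) (u v w : 'X_{1..m}).

(** Truncating the comparison to the first [k] coordinates lets the induction
    run inside a single type of exponents. Given a finite set dominating on the
    first [k] coordinates, any exponent whose coordinate [k] exceeds all those
    of that set is still dominated; the others lie in finitely many slices. *)
Lemma dickson_coords (k : nat) P :
  exists B : seq 'X_{1..m}, (forall b, b \in B -> P b) /\
    forall u, P u ->
      exists2 b, b \in B & forall i : 'I_m, (i < k)%N -> (b i <= u i)%N.
Proof.
elim: k P => [|k IH] P.
  have [[u Pu]|nP] := classic (exists u, P u).
    exists [:: u]; split=> [b|v _]; first by rewrite inE => /eqP->.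
    by exists u; rewrite ?mem_head.
  by exists [::]; split=> // u Pu; case: nP; exists u.
have [B [BP Bdom]] := IH P.
have [mk|km] := leqP m k.
  exists B; split=> // u /Bdom [b bB bu]; exists b => // i _.
  exact/bu/(leq_trans (ltn_ord i)).
pose ik := Ordinal km.
have slices N : exists C : seq 'X_{1..m}, (forall b, b \in C -> P b) /\
    forall u, P u -> (u ik < N)%N ->
      exists2 b, b \in C & forall i : 'I_m, (i < k.+1)%N -> (b i <= u i)%N.
  elim: N => [|N [C [CP Cdom]]]; first by exists [::].
  have [D [DP Ddom]] := IH (fun u => P u /\ u ik = N).
  exists (C ++ D); split=> [b|u Pu].
    by rewrite mem_cat => /orP [/CP|/DP []].
  rewrite ltnS leq_eqVlt => /predU1P [uN|/(Cdom _ Pu) [b bC bu]]; last first.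
    by exists b; rewrite // mem_cat bC.
  have [b bD bu] := Ddom u (conj Pu uN).
  exists b => [|i]; first by rewrite mem_cat bD orbT.
  rewrite ltnS leq_eqVlt => /predU1P [ik_eq|/bu//].
  have -> : i = ik by apply: val_inj.
  by have [_ ->] := DP b bD; rewrite uN.
have [C [CP Cdom]] := slices (\max_(b <- B) b ik).
exists (B ++ C); split=> [b|u Pu]; first by rewrite mem_cat => /orP [/BP|/CP].
have [/(Cdom _ Pu) [b bC bu]|ge_max] := ltnP (u ik) (\max_(b <- B) b ik).
  by exists b; rewrite // mem_cat bC orbT.
have [b bB bu] := Bdom u Pu.
exists b => [|i]; first by rewrite mem_cat bB.
rewrite ltnS leq_eqVlt => /predU1P [ik_eq|/bu//].
have -> : i = ik by apply: val_inj.
exact: leq_trans (leq_bigmax_seq b bB isT) ge_max.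
Qed.

Lemma lem_anti u v : (u <= v)%MM -> (v <= u)%MM -> u = v.
Proof.
move=> /mnm_lepP uv /mnm_lepP vu; apply/mnmP => i.
by apply/eqP; rewrite eqn_leq uv vu.
Qed.

Lemma lem_mdeg_eq u v : (u <= v)%MM -> (mdeg v <= mdeg u)%N -> u = v.
Proof.
move=> /submK <-; rewrite mdegD -[leqRHS]add0n leq_add2r leqn0 mdeg_eq0.
by move=> /eqP->; rewrite add0m.
Qed.

(** The list [B] is the antichain of minimal elements of [P]: it is what the
    minimal generators of a monomial ideal become on exponents. *)
Lemma dickson P :
  exists B : seq 'X_{1..m},
    [/\ forall b, b \in B -> P b,
        forall u, P u -> exists2 b, b \in B & (b <= u)%MM
      & forall b c, b \in B -> c \in B -> (b <= c)%MM -> b = c].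
Proof.
have [B [BP Bdom]] := dickson_coords m P.
have {}Bdom u : P u -> exists2 b, b \in B & (b <= u)%MM.
  by move=> /Bdom [b bB bu]; exists b => //; apply/mnm_lepP => i; apply: bu.
pose minimal b := all (fun c => (c <= b)%MM ==> (c == b)) B.
exists [seq b <- B | minimal b]; split=> [b|u|b c].
- by rewrite mem_filter => /andP [_ /BP].
- move: {2}(mdeg u).+1 (ltnSn (mdeg u)) => d; elim: d u => // d IH u ud Pu.
  have [b bB bu] := Bdom u Pu.
  have [bmin|/allPn [c cB]] := boolP (minimal b).
    by exists b; rewrite // mem_filter bmin.
  rewrite negb_imply => /andP [cb /eqP neq_cb].
  have [|e eB ec] := IH c _ (BP c cB); last first.
    by exists e => //; apply: lepm_trans ec (lepm_trans cb bu).
  rewrite -ltnS; apply: leq_trans ud; rewrite ltnS ltnNge; apply/negP => uc.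
  apply: neq_cb.
  apply: lem_anti (cb) _; rewrite (_ : c = u) //.
  exact: lem_mdeg_eq (lepm_trans cb bu) uc.
- rewrite !mem_filter => /andP [_ bB] /andP [/allP cmin _] bc.
  by apply/eqP; have := cmin b bB; rewrite bc.
Qed.

End Dickson.

(** * Monomial orders *)

Section MonomialOrders.
Context {m : nat}.
Implicit Types (le : rel 'X_{1..m}) (u v w : 'X_{1..m}).

Lemma monomial_order_refl le : monomial_order le -> reflexive le.
Proof. by case=> tot _ _ _ _ u; have := tot u u; rewrite orbb. Qed.

Lemma monomial_order_lem le u v :
  monomial_order le -> (u <= v)%MM -> le u v.
Proof.
case=> _ _ _ addr ge0 /submK <-; rewrite -{1}(add0m u); exact/addr/ge0.
Qed.

(** Monomial orders are well-orders: the least element of a finite set that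
    dominates [P] under divisibility is least in [P]. *)
Lemma monomial_order_least le (P : 'X_{1..m} -> Prop) u :
  monomial_order le -> P u -> exists2 v, P v & forall w, P w -> le v w.
Proof.
move=> mo Pu; have [tot _ tr _ _] := mo.
have [B [BP Bdom _]] := dickson P.
have [|v vB vmin] := exists_least_in_seq tot tr (s := B).
  by have [b] := Bdom u Pu; case: (B).
exists v => [|w /Bdom [b bB bw]]; first exact: BP.
exact: tr (vmin b bB) (monomial_order_lem mo bw).
Qed.

Lemma monomial_order_cancel le u v w :
  monomial_order le -> le (u + w)%MM (v + w)%MM -> le u v.
Proof.
move=> mo; have [tot anti _ addr _] := mo.
move=> uw_vw; have [//|vu] := orP (tot u v).
have /addIm -> : (u + w)%MM = (v + w)%MM by apply: anti; rewrite uw_vw addr.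
exact: monomial_order_refl.
Qed.

Lemma lead_exists (K : fieldType) le (p : {mpoly K[m]}) :
  monomial_order le -> p != 0 -> exists u, is_lead le p u.
Proof.
case=> tot _ tr _ _; rewrite -msupp_eq0 => p_neq0.
have [||u up umax] :=
    @exists_least_in_seq _ (fun u v => le v u) _ _ _ p_neq0.
- by move=> u v; apply: tot.
- by move=> v u w vu wv; apply: tr wv vu.
- by exists u; split.
Qed.

Lemma lead_uniq (K : fieldType) le (p : {mpoly K[m]}) u v :
  monomial_order le -> is_lead le p u -> is_lead le p v -> u = v.
Proof.
case=> _ anti _ _ _ [up umax] [vp vmax].
by apply: anti; rewrite vmax // umax.
Qed.

(** Ties in the weight are broken by the degree-lexicographic order of
    exponents. *)
Lemma weight_order (wt : 'X_{1..m} -> nat) :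
  {morph wt : u v / (u + v)%MM >-> (u + v)%N} ->
  monomial_order
    (fun u v => (wt u < wt v)%N || (wt u == wt v) && (u <= v)%O).
Proof.
move=> wtD; split=> [u v|u v|v u w|u v w|u].
- by case: (ltngtP (wt u) (wt v)) => //= _; apply: Order.TotalTheory.le_total.
- by case: (ltngtP (wt u) (wt v)) => //= _; apply: Order.POrderTheory.le_anti.
- case: (ltngtP (wt u) (wt v)) => //= [uv _|->].
    case: (ltngtP (wt v) (wt w)) => //= [/(ltn_trans uv) ->|<-] //.
    by rewrite uv.
  case: (ltngtP (wt v) (wt w)) => //= _; exact: Order.POrderTheory.le_trans.
- by rewrite !wtD ltn_add2r eqn_add2r lemc_add2l.
- have wt0 : wt 0%MM = 0%N.
    by apply/eqP; rewrite -(eqn_add2l (wt 0%MM)) -wtD !addm0 addn0.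
  by rewrite wt0 le0m andbT; case: (wt u).
Qed.

End MonomialOrders.

(** * Ideals *)

Section IdealTheory.
Context {m : nat} {K : fieldType}.
Implicit Types (S T I : {mpoly K[m]} -> Prop) (p f g : {mpoly K[m]}).
Implicit Types (u v w : 'X_{1..m}).

Lemma ideal_gen_mem S f : S f -> ideal_gen S f.
Proof.
move=> Sf; exists 1%N, (fun _ => 1), (fun _ => f); split=> //.
by rewrite big_ord1 mul1r.
Qed.

Lemma ideal_gen0 S : ideal_gen S 0.
Proof.
exists 0%N, (fun _ => 0), (fun _ => 0); split; first by case.
by rewrite big_ord0.
Qed.

Lemma ideal_genD S p f : ideal_gen S p -> ideal_gen S f -> ideal_gen S (p + f).
Proof.
move=> [k [c [g [Sg ->]]]] [l [d [h [Sh ->]]]].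
exists (k + l)%N,
  (fun i => match split i with inl j => c j | inr j => d j end),
  (fun i => match split i with inl j => g j | inr j => h j end).
split=> [i|]; first by case: (split i).
rewrite big_split_ord /=; congr (_ + _); apply: eq_bigr => i _.
  by rewrite (unsplitK (inl i)).
by rewrite (unsplitK (inr i)).
Qed.

Lemma ideal_genM S p f : ideal_gen S f -> ideal_gen S (p * f).
Proof.
move=> [k [c [g [Sg ->]]]]; exists k, (fun i => p * c i), g; split=> //.
by rewrite mulr_sumr; apply: eq_bigr => i _; rewrite mulrA.
Qed.

Lemma ideal_genN S f : ideal_gen S f -> ideal_gen S (- f).
Proof. by rewrite -mulN1r; apply: ideal_genM. Qed.

Lemma ideal_gen_sum S k (F : 'I_k -> {mpoly K[m]}) :
  (forall i, ideal_gen S (F i)) -> ideal_gen S (\sum_(i < k) F i).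
Proof.
by move=> SF; elim/big_ind: _ => //; [apply: ideal_gen0 | apply: ideal_genD].
Qed.

Lemma ideal_gen_sub S T :
  (forall f, S f -> ideal_gen T f) -> forall p, ideal_gen S p -> ideal_gen T p.
Proof.
move=> ST p [k [c [g [Sg ->]]]]; apply: ideal_gen_sum => i.
exact/ideal_genM/ST.
Qed.

(** Every monomial of an element of an ideal is a multiple of a monomial of
    some generator. All divisibility and degree bounds below come from this. *)
Lemma ideal_gen_supp S p u :
  ideal_gen S p -> u \in msupp p ->
  exists g v w, [/\ S g, w \in msupp g & u = (v + w)%MM].
Proof.
move=> [k [c [g [Sg ->]]]] /= up.
have [i ui] : exists i, u \in msupp (c i * g i).
  apply/existsP; apply: contraTT up; rewrite negb_exists => /forallP cg0.
  rewrite -mcoeff_eq0 raddf_sum big1 //= => i _; exact: memN_msupp_eq0.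
by have /allpairsP [[v w] [_ wg ->]] := msuppM_le ui; exists (g i), v, w.
Qed.

Lemma initial_ideal_lead le S f u :
  S f -> is_lead le f u -> initial_ideal le S 'X_[u].
Proof. by move=> Sf fu; apply: ideal_gen_mem; exists f, u. Qed.

Lemma initial_ideal_divides le S u :
  initial_ideal le S 'X_[u] ->
  exists f v, [/\ S f, is_lead le f v & (v <= u)%MM].
Proof.
have uu : u \in msupp ('X_[u] : {mpoly K[m]}) by rewrite msuppX mem_head.
move=> /ideal_gen_supp/(_ uu) [h [v [w [[f [t [Sf ft ->]]]]]]].
move=> /mem_msuppXP <- ->.
by exists f, t; split=> //; apply: lem_addl.
Qed.

Lemma mcoeff_binomial u v w :
  ('X_[u] - 'X_[v] : {mpoly K[m]})@_w = (u == w)%:R - (v == w)%:R.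
Proof. by rewrite mcoeffB !mcoeffX. Qed.

Lemma msupp_binomial u v w :
  w \in msupp ('X_[u] - 'X_[v] : {mpoly K[m]}) -> w = u \/ w = v.
Proof.
have [->|wu] := eqVneq w u; first by left.
have [->|wv] := eqVneq w v; first by right.
rewrite mcoeff_msupp mcoeff_binomial ![_ == w]eq_sym (negbTE wu) (negbTE wv).
by rewrite subrr eqxx.
Qed.

Lemma msupp_binomial_l u v :
  u != v -> u \in msupp ('X_[u] - 'X_[v] : {mpoly K[m]}).
Proof.
move=> uv; rewrite mcoeff_msupp mcoeff_binomial eqxx [v == u]eq_sym.
by rewrite (negbTE uv) subr0 oner_neq0.
Qed.

Lemma lead_binomial le u v :
  monomial_order le -> u != v -> le v u ->
  is_lead le ('X_[u] - 'X_[v] : {mpoly K[m]}) u.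
Proof.
move=> mo uv vu; split=> [|w /msupp_binomial [->|->]] //.
  exact: msupp_binomial_l.
exact: monomial_order_refl.
Qed.

End IdealTheory.

(** * Fibres of the grading *)

Section Fibres.
Context {n m : nat} (a : 'I_m -> 'rV[nat]_n).
Implicit Types (u v w : 'X_{1..m}) (le : rel 'X_{1..m}).

Lemma degAD u v : degA a (u + v)%MM = degA a u + degA a v.
Proof.
by rewrite /degA -big_split; apply: eq_bigr => i _ /=; rewrite mnmDE mulrnDr.
Qed.

Lemma rVnat_addIr (d : 'rV[nat]_n) : injective (fun c => c + d).
Proof.
move=> b c /rowP bc; apply/rowP => j; move: (bc j); rewrite !mxE.
exact: addIn.
Qed.

(** For toric ideals these are the standard monomials in the usual sense: they
    are the monomials outside the initial ideal. *)
Definition standard le v := forall w, degA a w = degA a v -> le v w.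

Lemma standard_exists le u :
  monomial_order le ->
  exists v, [/\ degA a v = degA a u, standard le v & le v u].
Proof.
move=> mo.
have [v vu vmin] :=
  monomial_order_least (P := fun v => degA a v = degA a u) mo (erefl _).
by exists v; split=> // [w wv|]; apply: vmin; rewrite // wv.
Qed.

Lemma standard_uniq le u v :
  monomial_order le -> degA a u = degA a v ->
  standard le u -> standard le v -> u = v.
Proof.
case=> _ anti _ _ _ uv umin vmin; apply: anti.
by rewrite umin // vmin.
Qed.

(** A smaller monomial in the fibre of [u], multiplied by [v - u], would be a
    smaller monomial in the fibre of [v]. *)
Lemma standard_divisor le u v :
  monomial_order le -> (u <= v)%MM -> standard le v -> standard le u.
Proof.
move=> mo /submK <- vmin w wu.
apply: (monomial_order_cancel (w := (v - u)%MM)) => //.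
by rewrite [X in le X]addmC; apply: vmin; rewrite addmC !degAD wu addrC.
Qed.

End Fibres.

(** * Gröbner bases of toric ideals *)

Section Toric.
Context {K : fieldType} {n m : nat} (a : 'I_m -> 'rV[nat]_n).
Implicit Types (u v w : 'X_{1..m}) (le : rel 'X_{1..m}).
Implicit Types (p f g : {mpoly K[m]}) (G : seq {mpoly K[m]}).
Local Notation I_A := (toric_ideal K a).

Lemma toric_binomial u v : degA a u = degA a v -> I_A ('X_[u] - 'X_[v]).
Proof. by move=> uv; apply: ideal_gen_mem; exists u, v. Qed.

Definition mnm_of_row (d : 'rV[nat]_n) : 'X_{1..n} :=
  [multinom d ord0 j | j < n].

Lemma mnm_of_row_inj : injective mnm_of_row.
Proof.
move=> b c /mnmP bc; apply/rowP => j; have := bc j; rewrite !mnmE.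
by [].
Qed.

(** The monomial parametrisation x_i |-> t^(a_i), of which I_A is the kernel;
    only the inclusion of I_A in the kernel is established here. *)
Definition toric_param (i : 'I_m) : {mpoly K[n]} := 'X_[mnm_of_row (a i)].

Definition toric_map : {mpoly K[m]} -> {mpoly K[n]} :=
  mmap (@mpolyC n K) toric_param.

Lemma toric_param_mnm u : mmap1 toric_param u = 'X_[mnm_of_row (degA a u)].
Proof.
have -> : mnm_of_row (degA a u) =
    (\big[+%MM/0%MM]_(i < m) (mnm_of_row (a i) *+ u i))%MM.
  apply/mnmP => j; rewrite mnm_sumE mnmE /degA summxE.
  by apply: eq_bigr => i _; rewrite mulmnE mnmE mulmxnE -mulr_natr natn.
exact: mprodXnE.
Qed.

Lemma toric_mapE p :
  toric_map p = \sum_(u <- msupp p) p@_u *: 'X_[mnm_of_row (degA a u)].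
Proof.
by apply: eq_bigr => u _; rewrite toric_param_mnm mul_mpolyC.
Qed.

Lemma toric_map_eq0 p : I_A p -> toric_map p = 0.
Proof.
move=> [k [c [g [gP ->]]]]; rewrite /toric_map raddf_sum big1 //= => i _.
have [u [v [uv ->]]] := gP i.
by rewrite rmorphM rmorphB /= !mmapX !toric_param_mnm uv subrr mulr0.
Qed.

(** The coefficient of t^d in the image of [p] is the sum of the coefficients
    of [p] over the fibre of [d]. It vanishes, so no fibre contributes a single
    monomial to [p]. *)
Lemma toric_fibre p u :
  I_A p -> u \in msupp p ->
  exists v, [/\ v \in msupp p, v != u & degA a v = degA a u].
Proof.
move=> Ip up.
suff /hasP [v vp /andP [vu /eqP uv]] :
    has (fun v => (v != u) && (degA a v == degA a u)) (msupp p) by exists v.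
apply: contraTT (up) => /hasPn alone.
have := congr1 (mcoeff (mnm_of_row (degA a u))) (toric_map_eq0 Ip).
rewrite toric_mapE raddf_sum (bigD1_seq u) //= mcoeff0 big_seq_cond big1.
  by rewrite addr0 mcoeffZ mcoeffX eqxx mulr1 => /eqP; rewrite mcoeff_eq0.
move=> v /andP [/alone + vu]; rewrite vu /= => neq.
by rewrite mcoeffZ mcoeffX (inj_eq mnm_of_row_inj) (negbTE neq) mulr0.
Qed.

(** The leading monomial shares its fibre with another, smaller, monomial of
    [p]. *)
Lemma lead_not_standard le p u :
  monomial_order le -> I_A p -> is_lead le p u -> ~ standard a le u.
Proof.
move=> [_ anti _ _ _] Ip [up umax] umin.
have [v [vp /eqP neq uv]] := toric_fibre Ip up.
by apply: neq; apply: anti; rewrite umax // umin.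
Qed.

Lemma not_standard_initial le u :
  monomial_order le -> ~ standard a le u -> initial_ideal le I_A 'X_[u].
Proof.
move=> mo nstd; have [v [vu vstd v_le]] := standard_exists a u mo.
have uv : u != v by apply/eqP => uv; apply: nstd; rewrite uv.
by apply: initial_ideal_lead (lead_binomial mo uv v_le); apply: toric_binomial.
Qed.

(** The basis consists of the binomials [x^b - x^w] with [b] minimal among
    non-standard exponents and [w] standard in the fibre of [b]. Reducedness
    holds because the [b] form an antichain, and because divisors of a standard
    monomial are standard. *)
Lemma reduced_groebner_basis_exists le :
  monomial_order le -> exists G, reduced_groebner_basis le I_A G.
Proof.
move=> mo; have [B [Bnstd Bdom Banti]] := dickson (fun u => ~ standard a le u).
pose R u (g : {mpoly K[m]}) := exists w,
  [/\ degA a w = degA a u, standard a le w, is_lead le g u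
    & g = 'X_[u] - 'X_[w]].
have [|G [BG GB]] := @seq_image_exists _ _ R B.
  move=> u uB; have [w [wu wstd w_le]] := standard_exists a u mo.
  have uw : u != w by apply/eqP => uw; apply: (Bnstd u uB); rewrite uw.
  by exists ('X_[u] - 'X_[w]), w; split=> //; apply: lead_binomial.
have GI g : g \in G -> I_A g.
  by move=> /GB [u _ [w [wu _ _ ->]]]; apply: toric_binomial.
exists G; split.
- split=> // p; split; apply: ideal_gen_sub => _ [f [u [fG fu ->]]].
    exact: initial_ideal_lead (GI f fG) fu.
  have [b bB /submK <-] := Bdom u (lead_not_standard mo fG fu).
  have [g gG [w [_ _ gb _]]] := BG b bB.
  by rewrite mpolyXD; apply/ideal_genM; apply: initial_ideal_lead gG gb.
- move=> g /GB [u uB [w [_ wstd gu gE]]]; exists u => //.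
  rewrite gE mcoeff_binomial eqxx [w == u]negbTE ?subr0 //.
  by apply/eqP => wu; apply: (Bnstd u uB); rewrite -wu.
- move=> g g' u v /GB [b bB [w [wb wstd gb gE]]].
  move=> /GB [b' b'B [w' [wb' wstd' gb' gE']]] neq ug /(lead_uniq mo gb') <-.
  apply/negP => b'u; move: ug; rewrite {1}gE => /msupp_binomial [ub|uw].
    have b'b : b' = b by apply: Banti => //; rewrite -ub.
    move/eqP: neq; apply; rewrite gE gE' b'b; congr (_ - 'X_[_]).
    by apply: standard_uniq mo _ wstd wstd'; rewrite wb wb' b'b.
  by apply: (Bnstd b' b'B); apply: standard_divisor mo b'u _; rewrite uw.
Qed.

Lemma groebner_basis_divides le G u :
  monomial_order le -> groebner_basis le I_A G -> ~ standard a le u ->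
  exists g b, [/\ g \in G, is_lead le g b & (b <= u)%MM].
Proof.
move=> mo [_ GP] /(not_standard_initial mo) /GP; exact: initial_ideal_divides.
Qed.

(** All terms of [g] but the leading one are standard, by reducedness. Pick one
    of them, [v], in the fibre of the leading monomial [u]. If
    [g - (x^u - x^v)] were nonzero, its leading monomial would be a term of [g]
    other than [u], hence standard, which an element of the ideal forbids. *)
Lemma reduced_groebner_basis_binomial le G g :
  monomial_order le -> reduced_groebner_basis le I_A G -> g \in G ->
  exists u v, [/\ degA a u = degA a v, standard a le v,
                  is_lead le g u & g = 'X_[u] - 'X_[v]].
Proof.
move=> mo [GB lead1 red] gG; have [GI _] := GB.
have [u gu g1] := lead1 g gG; have [ug umax] := gu.
have tail_std w : w \in msupp g -> w != u -> standard a le w.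
  move=> wg wu; apply: NNPP => /(groebner_basis_divides mo GB).
  case=> g' [b [g'G g'b bw]].
  have [eq_g|neq] := eqVneq g g'; last first.
    by have := red _ _ _ _ gG g'G neq wg g'b; rewrite bw.
  (* A term of g divisible by the leading term of g itself is that term. *)
  case: mo (monomial_order_lem mo bw) => _ anti tr _ _ b_le.
  case: g'b => _ /(_ u); rewrite -eq_g => /(_ ug) u_le.
  move/eqP: wu; apply; apply: anti; rewrite umax //=; exact: tr u_le b_le.
have [v [vg vu uv]] := toric_fibre (GI g gG) ug.
exists u, v; split=> //; first exact: tail_std.
apply/eqP; rewrite -subr_eq0; apply/negP => /negP.
set r := g - _ => r_neq0.
have [w rw] := lead_exists mo r_neq0.
have Ir : I_A r.
  by apply: ideal_genD (GI g gG) _; apply/ideal_genN/toric_binomial.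
apply: (lead_not_standard mo Ir rw); case: rw => + _.
have [->|wu] := eqVneq w u.
  rewrite mcoeff_msupp mcoeffB mcoeff_binomial g1 eqxx (negbTE vu).
  by rewrite subr0 subrr eqxx.
rewrite mcoeff_msupp mcoeffB mcoeff_binomial [u == w]eq_sym (negbTE wu).
rewrite sub0r opprK.
have [<- _|_] := eqVneq v w; first exact: tail_std.
by rewrite addr0 -mcoeff_msupp => wg; apply: tail_std.
Qed.

(** It suffices to reduce each monomial to the standard one of its fibre modulo
    [G]. A least monomial for which this fails is not standard, and rewriting it
    with an element of [G] produces a smaller monomial of the same fibre. *)
Lemma reduced_groebner_basis_generates le G :
  monomial_order le -> reduced_groebner_basis le I_A G ->
  generates (fun g => g \in G) I_A.
Proof.
move=> mo rG; have [GB _ _] := rG; have [GI _] := GB.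
pose J := ideal_gen (fun g : {mpoly K[m]} => g \in G).
have to_std u v : degA a v = degA a u -> standard a le v -> J ('X_[u] - 'X_[v]).
  pose bad u := ~ forall v, degA a v = degA a u -> standard a le v ->
    J ('X_[u] - 'X_[v]).
  suff /NNPP : ~ bad u by apply.
  move=> /(monomial_order_least mo) [{v}{}u + umin]; apply=> v vu vstd.
  have [ustd|nstd] := classic (standard a le u).
    by rewrite (standard_uniq mo vu vstd ustd) subrr; apply: ideal_gen0.
  have [g [b [gG gb bu]]] := groebner_basis_divides mo GB nstd.
  have [b' [c [bc cstd gb' gE]]] := reduced_groebner_basis_binomial mo rG gG.
  have bb' := lead_uniq mo gb' gb; rewrite bb' in bc gE.
  set u' := (u - b + c)%MM.
  have u'u : degA a u' = degA a u.
    by rewrite /u' -[in RHS](submK bu) !degAD bc.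
  rewrite (_ : _ - _ = 'X_[u - b] * g + ('X_[u'] - 'X_[v])); last first.
    by rewrite gE mulrBr -!mpolyXD submK // addrA subrK.
  apply: ideal_genD; first exact/ideal_genM/ideal_gen_mem.
  apply: NNPP => u'bad.
  have /umin : bad u' by move/(_ v); rewrite u'u => /(_ vu vstd).
  rewrite -{1}(submK bu) /u' [X in le X]addmC [X in le _ X]addmC.
  move=> /(monomial_order_cancel mo) b_le.
  have := gb.1; rewrite (_ : b = c) in gE *; first by rewrite gE subrr msupp0.
  have [_ anti _ _ _] := mo.
  by apply: anti; rewrite b_le cstd.
move=> p; split; first exact: ideal_gen_sub.
apply: ideal_gen_sub => _ [u [v [uv ->]]].
have [w [wu wstd _]] := standard_exists a u mo.
rewrite (_ : _ - _ = ('X_[u] - 'X_[w]) - ('X_[v] - 'X_[w])); last first.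
  by rewrite opprB addrA subrK.
by apply/ideal_genD/ideal_genN; apply: to_std; rewrite // wu.
Qed.


(** * Quadratic toric ideals *)

(** Otherwise the component of degree [mdeg u] of [x^u - x^v] would be the
    monomial [x^u], but a toric ideal contains no monomial. *)
Lemma homogeneous_degA u v :
  homogeneous_ideal I_A -> degA a u = degA a v -> mdeg u = mdeg v.
Proof.
move=> homI uv; apply/eqP/negPn/negP => neq.
have /homI/(_ (mdeg u)) := toric_binomial uv.
rewrite pihomogB !pihomogX eqxx eq_sym (negbTE neq) subr0 => Iu.
have [|w [+ /eqP wu _]] := toric_fibre Iu (u := u).
  by rewrite msuppX mem_head.
by move=> /mem_msuppXP /esym.
Qed.

Lemma quadrics_supp (S : {mpoly K[m]} -> Prop) p u :
  (forall f, S f -> quadric f) -> ideal_gen S p -> u \in msupp p ->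
  (2 <= mdeg u)%N.
Proof.
move=> SQ Sp /(ideal_gen_supp Sp) [g [v [w [/SQ /andP [_ /dhomogP g2] wg ->]]]].
by rewrite mdegD (g2 w wg) leq_addl.
Qed.

Lemma quadric_generated_supp p u :
  generated_by_quadrics I_A -> I_A p -> u \in msupp p -> (2 <= mdeg u)%N.
Proof. by case=> Q [QP Qgen] /Qgen; apply: quadrics_supp. Qed.

Lemma toric_binomial_fibre u v :
  I_A ('X_[u] - 'X_[v]) -> u != v -> degA a u = degA a v.
Proof.
move=> Iuv uv.
have [w [w_in /eqP wu <-]] := toric_fibre Iuv (msupp_binomial_l uv).
by have [|->] := msupp_binomial w_in.
Qed.

Lemma pihomog_mul_dhomog c g d k : g \is d.-homog ->
  pihomog mdeg k (c * g) =
    (\sum_(u <- msupp c | (mdeg u + d == k)%N) c@_u *: 'X_[u]) * g.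
Proof.
move=> gd; rewrite {1}[c]mpolyE mulr_suml raddf_sum.
rewrite [in RHS]big_mkcond mulr_suml; apply: eq_bigr => u _ /=.
rewrite -scalerAl linearZ /=.
have ugd : 'X_[u] * g \is (mdeg u + d).-homog by rewrite dhomogM // dhomogX.
case: eqP => [<-|/eqP ne]; first by rewrite pihomog_dE // scalerAl.
by rewrite (pihomog_ne0 ne ugd) scaler0 mul0r.
Qed.

(** The quadrics of [S] already generate the ideal, so minimality of [S] makes
    them all of [S]. *)
Lemma markov_basis_quadric (S : {mpoly K[m]} -> Prop) f :
  homogeneous_ideal I_A -> generated_by_quadrics I_A ->
  markov_basis I_A S -> S f -> quadric f.
Proof.
move=> homI genI [Sbin Sgen Smin].
pose S2 g := S g /\ quadric g.
suff S2gen : generates S2 I_A.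
  by move=> /(Smin S2 _ S2gen) [] // g [].
move=> p; split.
  move=> S2p; apply/Sgen; apply: ideal_gen_sub S2p => g [Sg _].
  exact: ideal_gen_mem.
have [Q [QP Qgen]] := genI.
move=> /Qgen; apply: ideal_gen_sub => q Qq.
have /andP [_ q2] := QP q Qq.
have /Sgen [k [c [g [gS qE]]]] : I_A q by apply/Qgen/ideal_gen_mem.
(* Only generators of degree 2 contribute to the component of degree 2. *)
rewrite -(pihomog_dE q2) qE raddf_sum; apply: ideal_gen_sum => i /=.
have [u [v gE]] := Sbin _ (gS i).
have Ig : I_A (g i) by apply/Sgen/ideal_gen_mem.
have [uv|uv] := eqVneq u v.
  by rewrite gE uv subrr mulr0 raddf0; apply: ideal_gen0.
have u_g : u \in msupp (g i) by rewrite gE msupp_binomial_l.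
have g_homog : g i \is (mdeg u).-homog.
  rewrite gE rpredB ?dhomogX // (homogeneous_degA homI (u := u) (v := v)) //.
  by apply: toric_binomial_fibre; rewrite -?gE.
rewrite (pihomog_mul_dhomog _ _ g_homog).
have := quadric_generated_supp genI Ig u_g.
rewrite leq_eqVlt => /predU1P [u2|u_gt2].
  apply/ideal_genM/ideal_gen_mem; split=> //; rewrite /quadric u2 g_homog andbT.
  by rewrite -msupp_eq0; case: (msupp _) u_g.
rewrite big_pred0 ?mul0r; first exact: ideal_gen0.
by move=> w; apply: gtn_eqF; apply: leq_trans u_gt2 (leq_addl _ _).
Qed.

(** If [f] in [G] lies in the ideal of a subset [S] of [G], then by degrees the
    leading monomial of [f] occurs in some element of [S], and reducedness
    makes that element [f] itself. *)
Lemma reduced_groebner_basis_markov le G :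
  monomial_order le -> reduced_groebner_basis le I_A G ->
  (forall g, g \in G -> quadric g) -> markov_basis I_A (fun g => g \in G).
Proof.
move=> mo rG GQ; have Ggen := reduced_groebner_basis_generates mo rG.
split=> // [g gG|S SG Sgen f fG].
  have [u [v [_ _ _ ->]]] := reduced_groebner_basis_binomial mo rG gG.
  by exists u, v.
have [_ lead1 red] := rG; have [u fu _] := lead1 f fG; have [u_f _] := fu.
have /Sgen f_S : I_A f by apply/Ggen/ideal_gen_mem.
have [g [v [w [Sg wg uE]]]] := ideal_gen_supp f_S u_f.
have quad_deg h t : h \in G -> t \in msupp h -> mdeg t = 2%N.
  by move=> /GQ /andP [_ /dhomogP]; apply.
have v0 : v = 0%MM.
  apply/eqP; rewrite -mdeg_eq0 -(eqn_add2r (mdeg w)) -mdegD -uE.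
  by rewrite (quad_deg f u) // (quad_deg g w) // SG.
have [<- //|neq] := eqVneq g f.
have := red _ _ _ _ (SG _ Sg) fG neq wg fu.
by rewrite uE v0 add0m lepm_refl.
Qed.

(** The degree of [x^u] in the variables that do not divide [x^v]. *)
Definition weight_off v u : nat := \sum_(i < m | v i == 0%N) u i.

Lemma weight_offD v : {morph weight_off v : u w / (u + w)%MM >-> (u + w)%N}.
Proof.
by move=> u w; rewrite -big_split; apply: eq_bigr => i _; rewrite mnmDE.
Qed.

(** Otherwise [x^u - x^v] would be an element with a term of degree less than 2
    of an ideal generated by quadrics. *)
Lemma degA_small_inj u v :
  generated_by_quadrics I_A -> degA a u = degA a v -> (mdeg u < 2)%N -> u = v.
Proof.
move=> genI uv; rewrite ltnNge => /negP u_lt2; apply/eqP/negPn/negP => neq.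
apply: u_lt2; apply: quadric_generated_supp genI (toric_binomial uv) _.
exact: msupp_binomial_l.
Qed.

(** Here [x^v] has weight 0. A monomial of weight 0 in its fibre shares a
    variable with it; cancelling that variable leaves two linear monomials of
    equal A-degree, which coincide. *)
Lemma standard_weight_off v :
  homogeneous_ideal I_A -> generated_by_quadrics I_A -> mdeg v = 2%N ->
  standard a (fun u w => (weight_off v u < weight_off v w)%N
                || (weight_off v u == weight_off v w) && (u <= w)%O) v.
Proof.
move=> homI genI v2 t tv.
have -> : weight_off v v = 0%N by rewrite /weight_off big1 // => i /eqP.
have [/eqP t0|] := eqVneq (weight_off v t) 0%N; last first.
  by rewrite lt0n => ->.
have t2 : mdeg t = 2%N by rewrite (homogeneous_degA homI tv).
have [i ti] : exists i, t i != 0%N.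
  apply/existsP; apply: contraT; rewrite negb_exists => /forallP t_eq0.
  suff t_0 : t = 0%MM by rewrite t_0 mdeg0 in t2.
  by apply/mnmP => i; rewrite mnm0E; apply/eqP/negPn.
have vi : v i != 0%N.
  apply: contraNneq ti => vi; move: t0.
  by rewrite sum_nat_eq0 => /forallP /(_ i); rewrite vi eqxx.
suff -> : t = v by rewrite Order.POrderTheory.lexx orbT.
rewrite -(lep1mP i t) in ti; rewrite -(lep1mP i v) in vi.
rewrite -(submK ti) -(submK vi); congr (_ + _)%MM.
apply: degA_small_inj genI _ _.
  by apply: (@rVnat_addIr _ (degA a U_(i)%MM)); rewrite /= -!degAD !submK.
by move: t2; rewrite -{1}(submK ti) mdegD mdeg1 addn1 => -[->].
Qed.

(** For the order that makes [v] standard, [u] is not standard, and no proper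
    divisor of it is a leading monomial since those have degree at least 2. So
    [x^u] is the leading monomial of an element of the reduced basis, whose
    tail can only be [x^v]. *)
Lemma markov_basis_groebner (S : {mpoly K[m]} -> Prop) f :
  homogeneous_ideal I_A -> generated_by_quadrics I_A ->
  markov_basis I_A S -> S f -> universal_groebner_basis I_A f.
Proof.
move=> homI genI SM Sf; have [Sbin Sgen _] := SM.
have /andP [f_neq0 f2] := markov_basis_quadric homI genI SM Sf.
have [u [v fE]] := Sbin f Sf.
have If : I_A f by apply/Sgen/ideal_gen_mem.
have uv : u != v by apply: contraNneq f_neq0 => uv; rewrite fE uv subrr.
have uv_deg : degA a u = degA a v by apply: toric_binomial_fibre; rewrite -?fE.
have u2 : mdeg u = 2%N.
  by move/dhomogP: f2; apply; rewrite fE msupp_binomial_l.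
have v2 : mdeg v = 2%N by rewrite -(homogeneous_degA homI uv_deg).
have vstd := standard_weight_off homI genI v2.
have mo := weight_order (@weight_offD v).
set le := fun _ _ => _ in vstd mo.
have [G rG] := reduced_groebner_basis_exists mo; have [GB _ _] := rG.
exists le, G; split=> //.
have nstd : ~ standard a le u.
  by move=> ustd; move/eqP: uv; apply; apply: standard_uniq mo _ ustd vstd.
have [g [b [gG gb bu]]] := groebner_basis_divides mo GB nstd.
have [b' [c [bc cstd gb' gE]]] := reduced_groebner_basis_binomial mo rG gG.
have bb' := lead_uniq mo gb' gb; rewrite bb' in bc gE.
have b_eq : b = u.
  apply: lem_mdeg_eq bu _; rewrite u2.
  by apply: quadric_generated_supp genI (GB.1 g gG) gb.1.
rewrite fE (_ : v = c) -?b_eq -?gE //.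
by apply: standard_uniq mo _ vstd cstd; rewrite -uv_deg -b_eq.
Qed.

End Toric.

Lemma quadricN (K : fieldType) (m : nat) (f : {mpoly K[m]}) :
  quadric (- f) = quadric f.
Proof. by rewrite /quadric oppr_eq0 rpredN. Qed.

Theorem theorem2p5 (K : fieldType) (n m : nat) (a : 'I_m -> 'rV[nat]_n)
    (a_inj : injective a) (a_neq0 : forall i, a i != 0)
    (homI : homogeneous_ideal (toric_ideal K a)) :
  (generalized_robust (toric_ideal K a) /\
   generated_by_quadrics (toric_ideal K a)) <->
  (forall f, universal_groebner_basis (toric_ideal K a) f -> quadric f).
Proof.
split=> [[robust genI] f Uf|UQ].
  have [|[S [SM Sf]]|[S [SM Sf]]] := (robust f).1; first by left.
    exact: markov_basis_quadric homI genI SM Sf.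
  by rewrite -quadricN; apply: markov_basis_quadric homI genI SM Sf.
have genI : generated_by_quadrics (toric_ideal K a).
  have mo := @weight_order m (fun=> 0%N) (fun _ _ => erefl).
  have [G rG] := reduced_groebner_basis_exists (K := K) a mo.
  exists (fun g => g \in G); split; last first.
    exact: reduced_groebner_basis_generates mo rG.
  move=> g gG; apply: UQ; eexists; exists G.
  by split; [exact: mo | exact: rG |].
have UM f : universal_groebner_basis (toric_ideal K a) f ->
    universal_markov_basis (toric_ideal K a) f.
  move=> [le [G [mo rG fG]]]; exists (fun g => g \in G); split=> //.
  apply: (reduced_groebner_basis_markov mo rG) => g gG.
  by apply: UQ; exists le, G.
have MU f : universal_markov_basis (toric_ideal K a) f ->
    universal_groebner_basis (toric_ideal K a) f.
  by move=> [S [SM Sf]]; apply: markov_basis_groebner homI genI SM Sf.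
by split=> // f; split=> -[] => [/UM|/UM|/MU|/MU]; [left|right|left|right].
Qed.
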